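(* Let $A\in\mathbb{C}^{n\times n}$ be involutory, i.e. $A^2=I_n$, with $n=2m$ or $n=2m+1$. Assume that $A$ has exactly $\nu$ singular values $\sigma_1\ge\cdots\ge\sigma_\nu>1$ (with multiplicity), that $A$ has $\mu$ pairs $(1,1)$ of singular values $1$ associated with singular triplets $(\tilde u_j,\tilde v_j,1)$ and $(\tilde v_j,\tilde u_j,1)$, $j=1,\dots,\mu$, and that the remaining $n-2\nu-2\mu=\eta_1+\eta_2$ singular values are single singular values $1$ associated with singular triplets $(\hat u_j,s_j\hat u_j,1)$, $s_j\in\{+1,-1\}$, $j=1,\dots,\eta_1+\eta_2$, where exactly $\eta_1$ of the $s_j$ equal $+1$ and exactly $\eta_2$ equal $-1$; here all the vectors $\tilde u_1,\dots,\tilde u_\mu,\tilde v_1,\dots,\tilde v_\mu,\hat u_1,\dots,\hat u_{\eta_1+\eta_2}$ are orthonormal. Let $\eta=m-\nu-\mu$, and $\delta=\eta$ if $n=2m$, $\delta=\eta+1$ if $n=2m+1$ (so that $\eta_1+\eta_2=\delta+\eta$). Put $S=\operatorname{diag}(\sigma_1,\dots,\sigma_\nu)$, $D_\delta=\operatorname{diag}(s_1,\dots,s_\delta)$, $E_\eta=\operatorname{diag}(s_{\delta+1},\dots,s_{\delta+\eta})$. Then $A$ is unitarily similar to the real involutory matrix $$T\Sigma=\begin{bmatrix} 0&0&0&S^{-1}&0&0 \\ 0&0&0&0&I_\mu&0 \\ 0&0&D_\delta&0&0&0 \\ S&0&0&0&0&0 \\ 0&I_\mu&0&0&0&0 \\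 0&0&0&0&0&E_\eta \end{bmatrix},$$ and $A$ is diagonalizable, being similar to $\operatorname{diag}(-I_{\nu+\mu+\eta_2},\,I_{\nu+\mu+\eta_1})$.
   Context: $I_j$ is the $j\times j$ identity matrix; $X^H$ is the conjugate transpose. A singular triplet of $A$ is $(u,v,\sigma)$ with $u$ a left and $v$ a right singular vector of $A$ for the singular value $\sigma$: $u,v\in\mathbb{C}^n$ are unit vectors with $Av=\sigma u$ and $A^Hu=\sigma v$. Here $\Sigma=\operatorname{diag}(S,I_\mu,I_\delta,S^{-1},I_\mu,I_\eta)$ and $$T=\begin{bmatrix} 0&0&I_{\nu+\mu}&0 \\ 0&D_\delta&0&0 \\ I_{\nu+\mu}&0&0&0 \\ 0&0&0&E_\eta \end{bmatrix}.$$ Two matrices $A,B$ are unitarily similar if $A=WBW^H$ for some unitary $W$. Empty blocks (size $0$) are allowed. *)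

(* Defs.v *)
From mathcomp Require Export all_boot all_order all_algebra.
From mathcomp Require Export complex reals.

Set Implicit Arguments.
Unset Strict Implicit.
Unset Printing Implicit Defensive.

Import Order.TTheory GRing.Theory Num.Theory.
Local Open Scope ring_scope.
Local Open Scope sesquilinear_scope.
Local Open Scope complex_scope.

Definition involutory (F : pzRingType) n (A : 'M[F]_n) : Prop :=
  A *m A = 1%:M.

Section SingularValues.
Variables (R : realType) (n : nat).
Implicit Types (A : 'M[R[i]]_n) (u v : 'cV[R[i]]_n).

(* The square roots of the eigenvalues of A^H A, with multiplicity, in
   nonincreasing order. [A^t* *m A] is normal, so [spectral_diag] lists its
   eigenvalues; they are real and nonnegative, hence equal to their real parts. *)
Definition singular_values A : seq R :=
  sort >=%R
    [seq Num.sqrt (complex.Re (spectral_diag (A^t* *m A) 0 j)) | j <- enum 'I_n].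

Definition singular_triplet A u v (x : R) : Prop :=
  [/\ u^t* *m u = 1%:M, v^t* *m v = 1%:M, 0 <= x,
      A *m v = x%:C *: u & A^t* *m u = x%:C *: v].

(* Indexed by position, so a repeated vector is not orthonormal. *)
Definition orthonormal (X : seq 'cV[R[i]]_n) : Prop :=
  forall j k, (j < size X)%N -> (k < size X)%N ->
    (X`_j)^t* *m X`_k = (j == k)%:R%:M.

Definition unitarily_similar A (B : 'M[R[i]]_n) : Prop :=
  exists2 W : 'M[R[i]]_n, W \is unitarymx & A = W *m B *m W^t*.

End SingularValues.

Section Blocks.
Variables (R : realType) (nu mu delta eta : nat).
Implicit Types (S : 'M[R]_nu) (D : 'M[R]_delta) (E : 'M[R]_eta).

(* All block matrices use the splitting ((nu + mu) + delta) + ((nu + mu) + eta)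
   of the index set. *)

(* T = [0 0 I 0; 0 D 0 0; I 0 0 0; 0 0 0 E] *)
Definition Tmx D E : 'M[R]_((nu + mu + delta) + (nu + mu + eta)) :=
  block_mx
    (block_mx 0 0 0 D)    (block_mx 1%:M 0 0 0)
    (block_mx 1%:M 0 0 0) (block_mx 0 0 0 E).

(* Sigma = diag(S, I_mu, I_delta, S^-1, I_mu, I_eta) *)
Definition Sigmamx S : 'M[R]_((nu + mu + delta) + (nu + mu + eta)) :=
  block_mx
    (block_mx (block_mx S 0 0 1%:M) 0 0 1%:M) 0
    0 (block_mx (block_mx (invmx S) 0 0 1%:M) 0 0 1%:M).

(* [0   0   0  S^-1  0    0]
   [0   0   0  0     I_mu 0]
   [0   0   D  0     0    0]
   [S   0   0  0     0    0]
   [0  I_mu 0  0     0    0]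
   [0   0   0  0     0    E] *)
Definition TSigmamx S D E : 'M[R]_((nu + mu + delta) + (nu + mu + eta)) :=
  block_mx
    (block_mx 0 0
              0 D)
    (block_mx (block_mx (invmx S) 0 0 1%:M) 0
              0                             0)
    (block_mx (block_mx S 0 0 1%:M)         0
              0                             0)
    (block_mx 0 0
              0 E).

End Blocks.

Arguments Tmx {R} nu mu {delta eta} D E.
Arguments Sigmamx {R nu} mu delta eta S.
Arguments TSigmamx {R nu} mu {delta eta} S D E.

(* Main.v *)
Require Import Defs.
From mathcomp Require Import zify.

Set Implicit Arguments.
Unset Strict Implicit.
Unset Printing Implicit Defensive.

Import Order.TTheory GRing.Theory Num.Theory.
Local Open Scope ring_scope.
Local Open Scope sesquilinear_scope.

(** Put H = A^H A, a hermitian matrix, and let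
    v_1, ..., v_nu be orthonormal eigenvectors of H for the eigenvalues
    sigma_j^2 > 1; they come from the spectral theorem ([singular_vectors]).
    As A is its own inverse, A carries the sigma_j^2-eigenspace of H to the
    sigma_j^-2-eigenspace ([involutory_gram_inverse]).  Hence the left singular
    vectors u_j = sigma_j^-1 A v_j are again orthonormal, A v_j = sigma_j u_j,
    and A u_j = sigma_j^-1 v_j.  The prescribed vectors all are eigenvectors of
    H for the eigenvalue 1, because A and A^H exchange each pair, and act by
    the same sign on each single vector.

    The eigenvalues sigma^2 > 1, the eigenvalue 1 and sigma^-2 < 1 are
    distinct, and eigenvectors of H for distinct real eigenvalues are
    orthogonal ([gram_eigen0]).  So the v_j, the u_j and the prescribed vectors
    form an orthonormal family of n vectors.  Ordered as
    W = [V, X, Z1, U, Y, Z2], where X and Y hold the two halves of the pairs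
    and Z1, Z2 the single vectors, it satisfies A W = W (T Sigma) by
    inspection of the columns ([unitary_basis]); this is the unitary
    similarity.

    For the diagonal form, 1 - A and 1 + A have product 0 and sum 2, so their
    ranks add up to n and bases of their row spaces, which consist of left
    eigenvectors for -1 and 1, diagonalize A ([involutory_signature]).  The
    trace of A is the number of eigenvalues 1 minus the number of eigenvalues
    -1, and equals the trace of T Sigma, the sum eta1 - eta2 of the signs; with
    the size n, this fixes both multiplicities ([involutory_similar_diag]). *)

(** * Involutory matrices up to similarity *)

(** Stated for a row-full P because the size k is only propositionally equal
    to n, so that invertibility of P is not expressible. *)
Lemma similar_castmx (F : fieldType) n k (e : k = n) (A : 'M[F]_n)
    (B : 'M[F]_k) (P : 'M[F]_(k, n)) :
  row_full P -> P *m A = B *m P -> similar_in unitmx A (castmx (e, e) B).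
Proof.
case: n / e A P => A P; rewrite castmx_id row_full_unit => Pu PA.
by exists P => //; apply/similarP.
Qed.

Lemma mxtrace_castmx (V : nmodType) n k (e : k = n) (B : 'M[V]_k) :
  \tr (castmx (e, e) B) = \tr B.
Proof. by case: n / e; rewrite castmx_id. Qed.

Lemma mxtrace_similar (F : fieldType) n (A B P : 'M[F]_n) :
  P \in unitmx -> similar P A B -> \tr A = \tr B.
Proof.
move=> Pu /(similarRL Pu) ->.
by rewrite mxtrace_mulC mulmxA mulVmx // mul1mx.
Qed.

(** The rows of 1 - A and of 1 + A are left eigenvectors of A for -1 and 1;
    they span the whole space because the sum of the two matrices is the
    invertible matrix 2, and the two ranks add up to at most n because their
    product is 0. *)
Lemma involutory_signature (F : numFieldType) n (A : 'M[F]_n) :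
  involutory A -> exists a b, exists e : (a + b = n)%N,
    similar_in unitmx A (castmx (e, e) (block_mx (- 1%:M) 0 0 1%:M)).
Proof.
rewrite /involutory => AA.
have Bm : (1%:M - A) *m A = - (1%:M - A).
  by rewrite mulmxBl mul1mx AA opprB.
have Bp : (1%:M + A) *m A = 1%:M + A.
  by rewrite mulmxDl mul1mx AA addrC.
have two0 : (2 : F) != 0 by rewrite pnatr_eq0.
have sum2 : (1%:M - A) + (1%:M + A) = 2%:M.
  by rewrite addrACA addNr addr0 -raddfD.
have e : (\rank (1%:M - A)%R + \rank (1%:M + A)%R = n)%N.
  apply/eqP; rewrite eqn_leq; apply/andP; split.
    by apply: mulmx0_rank_max; rewrite mulmxDr mulmx1 Bm subrr.
  apply: leq_trans (mxrank_add _ _); rewrite sum2.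
  by rewrite -(scalemx1 _ 2) mxrank_scale_nz // mxrank1.
exists (\rank (1%:M - A)%R), (\rank (1%:M + A)%R), e.
apply: (@similar_castmx _ _ _ _ _ _
  (col_mx (row_base (1%:M - A)) (row_base (1%:M + A)))); last first.
  rewrite mul_col_mx mul_block_col !mul0mx addr0 add0r mul1mx mulNmx mul1mx.
  have /submxP[K ->] : (row_base (1%:M - A)%R <= (1%:M - A)%R)%MS.
    by rewrite eq_row_base.
  have /submxP[L ->] : (row_base (1%:M + A)%R <= (1%:M + A)%R)%MS.
    by rewrite eq_row_base.
  by rewrite -!mulmxA Bm Bp mulmxN.
rewrite -sub1mx -addsmxE -(eqmx_scale _ two0) scalemx1 -sum2.
by apply: addmx_sub_adds; rewrite eq_row_base.
Qed.

(** The size and the trace are the sum and the difference of the two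
    multiplicities, hence determine them in characteristic 0. *)
Lemma involutory_similar_diag (F : numFieldType) n q p (e : (q + p = n)%N)
    (A : 'M[F]_n) :
  involutory A -> \tr A = p%:R - q%:R ->
  similar_in unitmx A (castmx (e, e) (block_mx (- 1%:M) 0 0 1%:M)).
Proof.
move=> /involutory_signature[a [b [e' [P Pu simP]]]] trA.
have := mxtrace_similar Pu simP; rewrite trA mxtrace_castmx mxtrace_block.
rewrite raddfN /= !mxtrace1 [RHS]addrC => /(canRL (subrK _)) /esym.
rewrite addrAC => /(canRL (addrK _)); rewrite opprK -!natrD => /eqP.
rewrite eqr_nat => /eqP pq.
have eb : b = p by lia.
have ea : a = q by lia.
by subst a b; rewrite (eq_irrelevance e e'); exists P.
Qed.

Lemma is_diag_castmx (V : nmodType) n k (e : k = n) (B : 'M[V]_k) :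
  is_diag_mx (castmx (e, e) B) = is_diag_mx B.
Proof. by case: n / e; rewrite castmx_id. Qed.

Lemma involutory_diag_sign (F : comPzRingType) k (d : 'rV[F]_k) :
  (forall j, d 0 j * d 0 j = 1) -> involutory (diag_mx d).
Proof.
move=> dd; rewrite /involutory mulmx_diag -diag_const_mx.
by congr diag_mx; apply/rowP => j; rewrite !mxE dd.
Qed.

Lemma sum_sign (R : numDomainType) (s : seq R) :
  {in s, forall x, x = 1 \/ x = -1} ->
  \sum_(x <- s) x = (count_mem 1 s)%:R - (count_mem (-1) s)%:R.
Proof.
have m11 : (-1 == 1 :> R) = false.
  by rewrite lt_eqF // (lt_trans (ltrN10 _) ltr01).
elim: s => [|x s IHs] sP; first by rewrite big_nil subrr.
rewrite big_cons IHs => [|y ys]; last by apply: sP; rewrite inE ys orbT.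
have [->|->] := sP x (mem_head _ _); rewrite /= !eqxx.
  by rewrite eq_sym m11 natrD addrA.
by rewrite m11 add0n natrD opprD addrCA.
Qed.

(** * Orthogonality of families of columns *)

Section Adjoint.
Variable C : numClosedFieldType.

Lemma trmxC_mul m n p (P : 'M[C]_(m, n)) (Q : 'M[C]_(n, p)) :
  (P *m Q)^t* = Q^t* *m P^t*.
Proof. by rewrite trmx_mul map_mxM. Qed.

Lemma trmxC_row m n p (P : 'M[C]_(m, n)) (Q : 'M[C]_(m, p)) :
  (row_mx P Q)^t* = col_mx (P^t*) (Q^t*).
Proof. by rewrite tr_row_mx map_col_mx. Qed.

Lemma gram_sym0 m n p (P : 'M[C]_(m, n)) (Q : 'M[C]_(m, p)) :
  P^t* *m Q = 0 -> Q^t* *m P = 0.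
Proof.
by move=> PQ; rewrite -(trmxCK (_ *m _)) trmxC_mul trmxCK PQ trmx0 map_mx0.
Qed.

Lemma gram_row_mx m n p (P : 'M[C]_(m, n)) (Q : 'M[C]_(m, p)) :
  P^t* *m P = 1%:M -> Q^t* *m Q = 1%:M -> P^t* *m Q = 0 ->
  (row_mx P Q)^t* *m row_mx P Q = 1%:M.
Proof.
move=> PP QQ PQ; rewrite trmxC_row mul_col_row PP QQ PQ (gram_sym0 PQ).
by rewrite -scalar_mx_block.
Qed.

Lemma gram0_row_mx m n p q (B : 'M[C]_(m, n)) (P : 'M_(m, p))
    (Q : 'M_(m, q)) :
  B^t* *m P = 0 -> B^t* *m Q = 0 -> B^t* *m row_mx P Q = 0.
Proof. by move=> BP BQ; rewrite mul_mx_row BP BQ row_mx0. Qed.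

Lemma gram_row_mx0 m n p q (B : 'M[C]_(m, n)) (P : 'M_(m, p))
    (Q : 'M_(m, q)) :
  P^t* *m B = 0 -> Q^t* *m B = 0 -> (row_mx P Q)^t* *m B = 0.
Proof. by move=> PB QB; rewrite trmxC_row mul_col_mx PB QB col_mx0. Qed.

(** Comparing (H P)^H Q with P^H (H Q) entry by entry, each entry of P^H Q is
    killed by the difference of two eigenvalues. *)
Lemma gram_eigen0 n p q (H : 'M[C]_n) (P : 'M_(n, p)) (Q : 'M_(n, q))
    (a : 'rV_p) (b : 'rV_q) :
  H^t* = H -> H *m P = P *m diag_mx a -> H *m Q = Q *m diag_mx b ->
  (forall i j, (a 0 i)^* != b 0 j) -> P^t* *m Q = 0.
Proof.
move=> Hh HP HQ ab.
have : (H *m P)^t* *m Q = P^t* *m (H *m Q) by rewrite trmxC_mul Hh mulmxA.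
rewrite HP HQ trmxC_mul tr_diag_mx map_diag_mx -mulmxA [P^t* *m (Q *m _)]mulmxA.
move: (P^t* *m Q) => G; rewrite mul_diag_mx mul_mx_diag => /matrixP eqG.
apply/matrixP => i j; have := eqG i j; rewrite !mxE => /eqP.
rewrite mulrC -subr_eq0 -mulrBr mulf_eq0 subr_eq0 (negPf (ab i j)) orbF.
by move/eqP.
Qed.

Lemma gram_hermitian m n (A : 'M[C]_(m, n)) :
  (A^t* *m A)^t* = A^t* *m A.
Proof. by rewrite trmxC_mul trmxCK. Qed.

Lemma involutory_trmxC n (A : 'M[C]_n) : involutory A -> involutory (A^t*).
Proof.
by rewrite /involutory => AA; rewrite -trmxC_mul AA trmx1 map_mx1.
Qed.

(** If A^H A V = V L, applying the involution A^H gives A V = A^H V L, so that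
    A^H A (A V) = A^H V = A V L^-1: left multiplication by A inverts the
    eigenvalues of A^H A. *)
Lemma involutory_gram_inverse n p (A : 'M[C]_n) (V : 'M_(n, p))
    (L L' : 'M_p) :
  involutory A -> A^t* *m A *m V = V *m L -> L *m L' = 1%:M ->
  A^t* *m A *m (A *m V) = A *m V *m L'.
Proof.
move=> AA HV LL'; have AsAs := involutory_trmxC AA.
have AV : A *m V = A^t* *m V *m L.
  by rewrite -mulmxA -HV !mulmxA AsAs mul1mx.
rewrite [in RHS]AV -[RHS]mulmxA LL' mulmx1.
by rewrite -mulmxA (mulmxA A) AA mul1mx.
Qed.

End Adjoint.

Section Columns.
Variables (C : numClosedFieldType) (n : nat).
Implicit Types (A : 'M[C]_n) (f : nat -> 'cV[C]_n).

(** The index range is given by an offset a and a length k, so that the blocks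
    of a basis are consecutive ranges of one sequence of vectors and their
    orthogonality is a comparison of ranges. *)
Definition columns f a k : 'M[C]_(n, k) := \matrix_(i, j) f (a + j)%N i 0.

Lemma mul_columns A f b a k :
  (forall j : 'I_k, A *m f (a + j)%N = f (b + j)%N) ->
  A *m columns f a k = columns f b k.
Proof.
move=> Af; apply/matrixP => i j; rewrite !mxE -Af mxE.
by apply: eq_bigr => l _; rewrite mxE.
Qed.

Lemma mul_columns_diag A f a k (d : 'rV[C]_k) :
  (forall j : 'I_k, A *m f (a + j)%N = d 0 j *: f (a + j)%N) ->
  A *m columns f a k = columns f a k *m diag_mx d.
Proof.
move=> Af; rewrite mul_mx_diag; apply/matrixP => i j.
have := congr1 (fun v : 'cV_n => v i 0) (Af j); rewrite !mxE mulrC => <-.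
by apply: eq_bigr => l _; rewrite mxE.
Qed.

Lemma gram_columns f a k b l (i : 'I_k) (j : 'I_l) :
  ((columns f a k)^t* *m columns f b l) i j =
  ((f (a + i)%N)^t* *m f (b + j)%N) 0 0.
Proof. by rewrite !mxE; apply: eq_bigr => h _; rewrite !mxE. Qed.

Variables (f : nat -> 'cV[C]_n) (N : nat).
Hypothesis fO : forall j k, (j < N)%N -> (k < N)%N ->
  (f j)^t* *m f k = (j == k)%:R%:M.

Lemma gram_columns1 a k : (a + k <= N)%N ->
  (columns f a k)^t* *m columns f a k = 1%:M.
Proof.
move=> akN; apply/matrixP => i j; rewrite gram_columns fO; last 2 first.
- by have := ltn_ord i; lia.
- by have := ltn_ord j; lia.
by rewrite eqn_add2l !mxE.
Qed.

Lemma gram_columns0 a k b l : (a + k <= b)%N -> (b + l <= N)%N ->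
  (columns f a k)^t* *m columns f b l = 0.
Proof.
move=> akb blN; apply/matrixP => i j; have := ltn_ord i; have := ltn_ord j.
move=> lj ki; rewrite gram_columns fO; [|lia|lia].
have /negPf-> : (a + i != b + j)%N by lia.
by rewrite !mxE.
Qed.

End Columns.

Local Open Scope complex_scope.

(** * Singular vectors *)

(** The columns of the unitary diagonalization of A^H A at the positions where
    the singular value exceeds c.  The list of singular values is sorted and
    then filtered, so the positions are followed through both operations. *)
Lemma singular_vectors (R : realType) n nu (A : 'M[R[i]]_n)
    (sigma : nu.-tuple R) (c : R) :
  0 <= c -> [seq x <- singular_values A | c < x] = sigma ->
  exists2 V : 'M[R[i]]_(n, nu), V^t* *m V = 1%:M &
    A^t* *m A *m V = V *m diag_mx (\row_j ((tnth sigma j) ^+ 2)%:C).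
Proof.
move=> c0; rewrite /singular_values sort_map filter_map.
set H := A^t* *m A; set g := fun j => Num.sqrt _; set ks := filter _ _.
move=> ksE.
have Hherm : H \is hermsymmx.
  by apply/is_hermitianmxP; rewrite expr0 scale1r gram_hermitian.
have Hspec : H *m (spectralmx H)^t* =
    (spectralmx H)^t* *m diag_mx (spectral_diag H).
  have /orthomx_spectralP {1}-> := hermitian_normalmx Hherm.
  rewrite invmx_unitary ?spectral_unitarymx // -!mulmxA.
  by rewrite (unitarymxP (spectral_unitarymx H)) mulmx1.
have ks_uniq : uniq ks by rewrite filter_uniq // sort_uniq enum_uniq.
have sz : size ks = nu by rewrite -(size_tuple sigma) -ksE size_map.
pose h (j : 'I_nu) := tnth (in_tuple ks) (cast_ord (esym sz) j).
have hg j : g (h j) = tnth sigma j.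
  rewrite /h !(tnth_nth (g (h j))) -ksE (nth_map (h j)) ?sz //=.
  by rewrite (tnth_nth (h j)).
have lt_ks (j : 'I_nu) : (j < size ks)%N by rewrite sz.
have h_inj : injective h.
  move=> i j /(congr1 (index^~ ks)) /eqP.
  rewrite /h !(tnth_nth (h i)) /= !index_uniq // => /eqP.
  exact: val_inj.
exists (colsub h ((spectralmx H)^t*)).
  have -> : (colsub h ((spectralmx H)^t*))^t* = rowsub h (spectralmx H).
    by apply/matrixP => i j; rewrite !mxE conjCK.
  rewrite -mxsub_mul (unitarymxP (spectral_unitarymx H)).
  by apply/matrixP => i j; rewrite !mxE (inj_eq h_inj).
rewrite mulmx_colsub Hspec; apply/matrixP => i j.
rewrite !mul_mx_diag !mxE; congr (_ * _).
have d_real := mxOverP (hermitian_spectral_diag_real Hherm) 0 (h j).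
(* The square root is 0 on negative numbers, so a singular value > c >= 0
   comes from a positive eigenvalue, of which it is the genuine square root. *)
have d_gt0 : 0 < complex.Re (spectral_diag H 0 (h j)).
  rewrite -sqrtr_gt0 -[Num.sqrt _]/(g (h j)) hg.
  have : all (> c) sigma.
    by rewrite -ksE all_map; apply: filter_all.
  by move=> /allP/(_ _ (mem_tnth j _)); apply: le_lt_trans.
by rewrite -hg /g sqr_sqrtr ?(ltW d_gt0) // RRe_real.
Qed.

(** * The matrix T Sigma and the unitary similarity *)

Lemma unitarily_similar_castmx (R : realType) n k (e : k = n) (A : 'M[R[i]]_n)
    (B : 'M_k) (W : 'M_(n, k)) :
  W^t* *m W = 1%:M -> A *m W = W *m B ->
  unitarily_similar A (castmx (e, e) B).
Proof.
case: n / e A W => A W WW AW; rewrite castmx_id; exists W.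
  exact/unitarymxP/mulmx1C.
by rewrite -AW -mulmxA (mulmx1C WW) mulmx1.
Qed.

Lemma mxtrace_unitarily_similar (R : realType) n (A B : 'M[R[i]]_n) :
  unitarily_similar A B -> \tr A = \tr B.
Proof.
case=> W /unitarymxP/mulmx1C WW ->.
by rewrite mxtrace_mulC mulmxA WW mul1mx.
Qed.

Lemma Tmx_Sigmamx (R : realType) nu mu delta eta (S : 'M[R]_nu)
    (D : 'M_delta) (E : 'M_eta) :
  Tmx nu mu D E *m Sigmamx mu delta eta S = TSigmamx mu S D E.
Proof.
rewrite /Tmx /Sigmamx /TSigmamx !mulmx_block.
by rewrite !(mul0mx, mulmx0, mul1mx, mulmx1, addr0, add0r).
Qed.

Lemma TSigmamx_involutory (R : realType) nu mu delta eta (S : 'M[R]_nu)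
    (D : 'M_delta) (E : 'M_eta) :
  S \in unitmx -> involutory D -> involutory E ->
  involutory (TSigmamx mu S D E).
Proof.
rewrite /involutory => Su DD EE; rewrite /TSigmamx !mulmx_block.
rewrite !(mul0mx, mulmx0, mul1mx, mulmx1, addr0, add0r) mulVmx // mulmxV //.
rewrite DD EE !add_block_mx !(addr0, add0r) !block_mx0.
by rewrite -!scalar_mx_block.
Qed.

(** The orthonormal family [V, U, f] rearranged by blocks.  The sequence f
    lists the prescribed vectors: the first halves of the mu pairs, then their
    second halves, then the single vectors. *)
Lemma unitary_basis (R : realType) n nu mu delta eta (A : 'M[R[i]]_n)
    (sigma : nu.-tuple R)
    (V : 'M[R[i]]_(n, nu)) (f : nat -> 'cV[R[i]]_n) (s : seq R) :
  let N := (mu + mu + (delta + eta))%N in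
  let S : 'M[R]_nu := diag_mx (\row_j tnth sigma j) in
  let D : 'M[R]_delta := diag_mx (\row_j s`_j) in
  let E : 'M[R]_eta := diag_mx (\row_j s`_(delta + j)) in
  involutory A ->
  (forall j, 1 < tnth sigma j) ->
  V^t* *m V = 1%:M ->
  A^t* *m A *m V = V *m diag_mx (\row_j ((tnth sigma j) ^+ 2)%:C) ->
  (forall j k, (j < N)%N -> (k < N)%N -> (f j)^t* *m f k = (j == k)%:R%:M) ->
  (forall j, (j < N)%N -> A^t* *m A *m f j = f j) ->
  (forall j, (j < mu)%N -> A *m f j = f (mu + j)%N) ->
  (forall j, (j < mu)%N -> A *m f (mu + j)%N = f j) ->
  (forall j, (j < delta + eta)%N ->
    A *m f (mu + mu + j)%N = (s`_j)%:C *: f (mu + mu + j)%N) ->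
  exists2 W : 'M[R[i]]_(n, (nu + mu + delta) + (nu + mu + eta)),
    W^t* *m W = 1%:M &
    A *m W = W *m map_mx (real_complex R) (TSigmamx mu S D E).
Proof.
move=> N S D E AA sigma_gt1 VV HV fO Hf Afl Afr Afs.
pose H := A^t* *m A.
pose sg (j : 'I_nu) : R[i] := (tnth sigma j)%:C.
have sg_gt1 j : 1 < sg j by rewrite ltcR.
have sg_gt0 j : 0 < sg j := lt_trans ltr01 (sg_gt1 j).
have sg_conj j k : Num.conj (sg j ^ k)%R = (sg j ^ k)%R.
  by rewrite conj_Creal // rpredXz // gtr0_real.
(* diagX k is S^k over the complex numbers, where k may be negative. *)
pose diagX k : 'M[R[i]]_nu := diag_mx (\row_j (sg j ^ k)%R).
have diagXM k l : diagX k *m diagX l = diagX (k + l).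
  rewrite mulmx_diag; congr diag_mx; apply/rowP => j.
  by rewrite !mxE expfzDr // gt_eqF.
have diagX0 : diagX 0 = 1%:M.
  by rewrite -diag_const_mx; congr diag_mx; apply/rowP => j; rewrite !mxE.
have SE : map_mx (real_complex R) S = diagX 1.
  by rewrite map_diag_mx; congr diag_mx; apply/rowP => j; rewrite !mxE.
have SVE : map_mx (real_complex R) (invmx S) = diagX (-1).
  have [S1u _] : diagX 1 \in unitmx /\ diagX (-1) \in unitmx.
    by apply: mulmx1_unit; rewrite diagXM.
  by rewrite map_invmx SE -[LHS]mulmx1 -diagX0 -(subrr 1) -diagXM mulKmx.
have diagXC k : (diagX k)^t* = diagX k.
  rewrite tr_diag_mx map_diag_mx; congr diag_mx; apply/rowP => j.
  by rewrite !mxE; apply: sg_conj.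
have {}HV : H *m V = V *m diagX 2.
  rewrite /H HV; congr (_ *m diag_mx _); apply/rowP => j.
  by rewrite !mxE rmorphXn.
pose U := A *m V *m diagX (-1).
have AV : A *m V = U *m diagX 1 by rewrite -mulmxA diagXM addNr diagX0 mulmx1.
have AU : A *m U = V *m diagX (-1) by rewrite !mulmxA AA mul1mx.
have HU : H *m U = U *m diagX (-2).
  rewrite mulmxA (involutory_gram_inverse AA HV (L' := diagX (-2))) ?diagXM //.
  by rewrite -!mulmxA !diagXM.
have UU : U^t* *m U = 1%:M.
  have -> : U^t* *m U = diagX (-1) *m (V^t* *m (H *m V)) *m diagX (-1).
    by rewrite !trmxC_mul diagXC !mulmxA.
  by rewrite HV (mulmxA (V^t*)) VV mul1mx !diagXM -diagX0.
have sq_gt1 j : 1 < (sg j ^ 2)%R by rewrite exprn_egt1.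
have sqV_lt1 j : (sg j ^ (-2))%R < 1.
  by rewrite invf_lt1; [exact: sq_gt1 | apply: lt_trans (sq_gt1 j)].
have Hh : H^t* = H := gram_hermitian A.
(* V, the prescribed vectors and U belong to eigenvalues of H that are
   greater than 1, equal to 1, and less than 1, respectively. *)
have VU : V^t* *m U = 0.
  apply: (gram_eigen0 Hh HV HU) => i j; rewrite !mxE sg_conj gt_eqF //.
  exact: lt_trans (sqV_lt1 j) (sq_gt1 i).
have HQ a k : (a + k <= N)%N ->
    H *m columns f a k = columns f a k *m diag_mx (const_mx 1).
  move=> akN; rewrite diag_const_mx mulmx1; apply: mul_columns => j.
  by rewrite Hf //; have := ltn_ord j; lia.
have VQ a k : (a + k <= N)%N -> V^t* *m columns f a k = 0.
  move=> /HQ HQak; apply: (gram_eigen0 Hh HV HQak) => i j.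
  by rewrite !mxE sg_conj gt_eqF.
have UQ a k : (a + k <= N)%N -> U^t* *m columns f a k = 0.
  move=> /HQ HQak; apply: (gram_eigen0 Hh HU HQak) => i j.
  by rewrite !mxE sg_conj lt_eqF.
have QQ1 := gram_columns1 fO; have QQ0 := gram_columns0 fO.
have le0 : (0 + mu <= N)%N by lia.
have le1 : (mu + mu <= N)%N by lia.
have le2 : (mu + mu + delta <= N)%N by lia.
have le3 : (mu + mu + delta + eta <= N)%N by lia.
pose X := columns f 0 mu; pose Y := columns f mu mu.
pose Z1 := columns f (mu + mu) delta.
pose Z2 := columns f (mu + mu + delta) eta.
have AX : A *m X = Y by apply: mul_columns => j; exact: (Afl _ (ltn_ord j)).
have AY : A *m Y = X by apply: mul_columns => j; exact: (Afr _ (ltn_ord j)).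
have AZ1 : A *m Z1 = Z1 *m map_mx (real_complex R) D.
  rewrite map_diag_mx; apply: mul_columns_diag => j; rewrite !mxE Afs //.
  by have := ltn_ord j; lia.
have AZ2 : A *m Z2 = Z2 *m map_mx (real_complex R) E.
  rewrite map_diag_mx; apply: mul_columns_diag => j; rewrite !mxE -addnA Afs //.
  by have := ltn_ord j; lia.
exists (row_mx (row_mx (row_mx V X) Z1) (row_mx (row_mx U Y) Z2)).
  apply: gram_row_mx.
  - apply: gram_row_mx; [|exact: QQ1|].
      by apply: gram_row_mx; [exact: VV | exact: QQ1 | exact: VQ].
    by apply: gram_row_mx0; [exact: VQ | apply: QQ0; lia].
  - apply: gram_row_mx; [|exact: QQ1|].
      by apply: gram_row_mx; [exact: UU | exact: QQ1 | exact: UQ].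
    by apply: gram_row_mx0; [exact: UQ | apply: QQ0; lia].
  - apply: gram_row_mx0; first apply: gram_row_mx0.
    + apply: gram0_row_mx; first apply: gram0_row_mx.
      * exact: VU.
      * exact: VQ.
      * exact: VQ.
    + apply: gram0_row_mx; first apply: gram0_row_mx.
      * exact/gram_sym0/UQ.
      * by apply: QQ0; lia.
      * by apply: QQ0; lia.
    + apply: gram0_row_mx; first apply: gram0_row_mx.
      * exact/gram_sym0/UQ.
      * by apply: gram_sym0; apply: QQ0; lia.
      * by apply: QQ0; lia.
rewrite /TSigmamx !map_block_mx !map_mx0 !map_mx1 SE SVE.
rewrite !mul_mx_row AV AU AX AY AZ1 AZ2 !mul_row_block.
by rewrite !(mulmx0, mulmx1, addr0, add0r) !add_row_mx !(addr0, add0r).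
Qed.

Theorem corollary4 (R : realType) (n m nu mu eta1 eta2 eta delta : nat)
    (A : 'M[R[i]]_n)
    (sigma : nu.-tuple R)
    (ut vt : mu.-tuple 'cV[R[i]]_n)
    (uh : (eta1 + eta2).-tuple 'cV[R[i]]_n)
    (s : (eta1 + eta2).-tuple R)
    (A_invol : involutory A)
    (n_m_delta : (n = m.*2 /\ delta = eta) \/ (n = m.*2.+1 /\ delta = eta.+1))
    (eta_def : eta = (m - nu - mu)%N)
    (sigma_gt1 : [seq x <- singular_values A | 1 < x] = sigma)
    (pairs1 : forall j : 'I_mu,
        singular_triplet A (tnth ut j) (tnth vt j) 1 /\
        singular_triplet A (tnth vt j) (tnth ut j) 1)
    (remaining : n = (nu.*2 + mu.*2 + (eta1 + eta2))%N)
    (s_sign : forall j : 'I_(eta1 + eta2), tnth s j = 1 \/ tnth s j = -1)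
    (singles1 : forall j : 'I_(eta1 + eta2),
        singular_triplet A (tnth uh j) ((tnth s j)%:C *: tnth uh j) 1)
    (s_pos : count_mem 1 s = eta1)
    (s_neg : count_mem (-1) s = eta2)
    (vectors_orthonormal : orthonormal (ut ++ vt ++ uh)) :
  let S : 'M[R]_nu := diag_mx (\row_j tnth sigma j) in
  let D : 'M[R]_delta := diag_mx (\row_j s`_j) in
  let E : 'M[R]_eta := diag_mx (\row_j s`_(delta + j)) in
  let TSigma := Tmx nu mu D E *m Sigmamx mu delta eta S in
  [/\ TSigma = TSigmamx mu S D E,
      involutory TSigma,
      exists e : ((nu + mu + delta) + (nu + mu + eta) = n)%N,
        unitarily_similar A
          (castmx (e, e) (map_mx (real_complex R) TSigma)),
      diagonalizable A &
      exists e : ((nu + mu + eta2) + (nu + mu + eta1) = n)%N,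
        similar_in unitmx A
          (castmx (e, e) (block_mx (- 1%:M) 0 0 1%:M))].
Proof.
move=> S D E TSigma.
set X := (ut ++ vt ++ uh : seq _) in vectors_orthonormal.
have de : (delta + eta = eta1 + eta2)%N by lia.
have eN : ((nu + mu + delta) + (nu + mu + eta) = n)%N by lia.
have eK : ((nu + mu + eta2) + (nu + mu + eta1) = n)%N by lia.
have TS : TSigma = TSigmamx mu S D E by apply: Tmx_Sigmamx.
have ssz : size s = (delta + eta)%N by rewrite size_tuple.
have s1 j : (j < delta + eta)%N -> s`_j = 1 \/ s`_j = -1.
  rewrite de => lj; have := s_sign (Ordinal lj).
  by rewrite (tnth_nth 0).
have ss j : (j < delta + eta)%N -> s`_j * s`_j = 1.
  by move=> /s1[] ->; rewrite ?mulrNN mulr1.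
have sig1 j : 1 < tnth sigma j.
  have : all (> 1) sigma by rewrite -sigma_gt1 filter_all.
  by move/allP; apply; apply: mem_tnth.
have TSinv : involutory TSigma.
  rewrite TS; apply: TSigmamx_involutory.
  - rewrite unitmxE det_diag unitfE; apply/prodf_neq0 => j _.
    by rewrite mxE gt_eqF // (lt_trans ltr01).
  - by apply: involutory_diag_sign => j; rewrite mxE ss // ltn_addr.
  - by apply: involutory_diag_sign => j; rewrite mxE ss // ltn_add2l.
have [V VV HV] := singular_vectors ler01 sigma_gt1.
have szX : size X = (mu + mu + (delta + eta))%N.
  by rewrite !size_cat !size_tuple de addnA.
have Xu (j : 'I_mu) : X`_j = tnth ut j.
  by rewrite nth_cat size_tuple ltn_ord (tnth_nth 0).
have Xv (j : 'I_mu) : X`_(mu + j) = tnth vt j.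
  rewrite nth_cat size_tuple ltnNge leq_addr /= addKn.
  by rewrite nth_cat size_tuple ltn_ord (tnth_nth 0).
have Xs (j : 'I_(eta1 + eta2)) : X`_(mu + mu + j) = tnth uh j.
  rewrite -addnA nth_cat size_tuple ltnNge leq_addr /= addKn.
  by rewrite nth_cat size_tuple ltnNge leq_addr /= addKn (tnth_nth 0).
have pairA (j : 'I_mu) :
    [/\ A *m X`_j = X`_(mu + j), A *m X`_(mu + j) = X`_j,
        A^t* *m X`_j = X`_(mu + j) & A^t* *m X`_(mu + j) = X`_j].
  rewrite Xu Xv; have [[_ _ _ Av Au] [_ _ _ Au' Av']] := pairs1 j.
  by split; rewrite ?Av ?Au ?Au' ?Av' scale1r.
(* From A (s u) = u and s^2 = 1 follows A u = s u. *)
have singleA (j : 'I_(eta1 + eta2)) :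
    A *m X`_(mu + mu + j) = (s`_j)%:C *: X`_(mu + mu + j) /\
    A^t* *m X`_(mu + mu + j) = (s`_j)%:C *: X`_(mu + mu + j).
  rewrite Xs; have [_ _ _] := singles1 j; rewrite !scale1r.
  rewrite (tnth_nth 0) -scalemxAr => Au ->; split=> //.
  by rewrite -[in RHS]Au scalerA -rmorphM ss ?de // scale1r.
have HX k : (k < mu + mu + (delta + eta))%N -> A^t* *m A *m X`_k = X`_k.
  move=> lk; rewrite -mulmxA; have [lk1|gk1] := ltnP k mu.
    by have [/= -> _ _ ->] := pairA (Ordinal lk1).
  have [lk2|gk2] := ltnP k (mu + mu).
    have lk' : (k - mu < mu)%N by lia.
    by have [/=] := pairA (Ordinal lk'); rewrite /= subnKC // => _ -> ->.
  have lk' : (k - (mu + mu) < eta1 + eta2)%N by lia.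
  have [] := singleA (Ordinal lk'); rewrite /= subnKC // => -> Ah.
  by rewrite -scalemxAr Ah scalerA -rmorphM ss ?de // scale1r.
have XO j k : (j < mu + mu + (delta + eta))%N ->
    (k < mu + mu + (delta + eta))%N -> (X`_j)^t* *m X`_k = (j == k)%:R%:M.
  by rewrite -szX; apply: vectors_orthonormal.
have [W WW AW] := @unitary_basis R n nu mu delta eta A sigma V
  (fun k => X`_k) s A_invol sig1 VV HV XO HX
  (fun j lj => let: And4 e _ _ _ := pairA (Ordinal lj) in e)
  (fun j lj => let: And4 _ e _ _ := pairA (Ordinal lj) in e)
  (fun j lj => (singleA (Ordinal (etrans (congr1 (leq j.+1) (esym de)) lj))).1).
rewrite -/S -/D -/E -TS in AW.
have simA := unitarily_similar_castmx eN WW AW.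
have trA : \tr A = (nu + mu + eta1)%:R - (nu + mu + eta2)%:R.
  rewrite (mxtrace_unitarily_similar simA) mxtrace_castmx TS.
  rewrite trace_map_mx !mxtrace_block !mxtrace0 !add0r !mxtrace_diag.
  have -> : \sum_(j < delta) (\row_j s`_j) 0 j +
      \sum_(j < eta) (\row_j s`_(delta + j)) 0 j = \sum_(x <- s) x.
    rewrite (big_nth 0) big_mkord ssz big_split_ord /=.
    by congr (_ + _); apply: eq_bigr => j _; rewrite mxE.
  rewrite sum_sign => [|x xs]; last first.
    by have /(nthP 0)[j lj <-] := xs; apply: s1; rewrite -ssz.
  rewrite s_pos s_neg rmorphB !rmorph_nat !natrD opprD.
  by rewrite addrACA subrr add0r.
have simD := involutory_similar_diag eK A_invol trA.
split=> //; [by exists eN| |by exists eK].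
have [P Pu /eqP simP] := simD; exists P => //.
rewrite /similar_to simP is_diag_castmx is_diag_block_mx // !eqxx.
by rewrite -scaleN1r scalemx1 !scalar_mx_is_diag.
Qed.
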